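(* Some $n$-vertex graphs of treewidth $\tau$ require $\Omega(n\tau)$ voxels. Precisely: there is a constant $c>0$ such that for every integer $\tau\ge 1$ there are arbitrarily large integers $n$ for which there exists a graph $G$ with $n$ vertices and treewidth $\tau$ such that every voxel representation of $G$ has size at least $c\,n\,\tau$.
   Context: All graphs are finite and simple. A voxel is a cell of the unit cube grid in 3-dimensional space; two distinct voxels are adjacent if they share a face. A blob is a nonempty finite set of voxels that is connected with respect to this adjacency. A voxel representation of a graph $G=(V,E)$ assigns to each vertex $v\in V$ a blob $B_v$ such that the blobs of distinct vertices are disjoint and, for all distinct $u,v\in V$, some voxel of $B_u$ is adjacent to some voxel of $B_v$ if and only if $uv\in E$. Its size is $\sum_{v\in V}|B_v|$. Treewidth is the usual notion: the minimum, over all tree decompositions, of the maximum bag size minus $1$. *)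

(* Defs.v *)
From mathcomp Require Import all_boot all_order all_algebra finmap.
From mathcomp Require Import reals.

Set Implicit Arguments.
Unset Strict Implicit.
Unset Printing Implicit Defensive.

Record sgraph := SGraph {
  vertex :> finType;
  edge : rel vertex;
  edge_sym : symmetric edge;
  edge_irrefl : irreflexive edge
}.

(* A closed walk x, y, x along a single edge is a [ucycle] of size 2, so the
   cycles of a simple graph are exactly the [ucycle]s of size at least 3. *)
Definition is_tree (T : sgraph) : Prop :=
  [/\ 0 < #|T|,
      forall s t : T, connect (@edge T) s t
    & forall c : seq T, ucycle (@edge T) c -> size c <= 2].

Definition tree_decomposition (G T : sgraph) (bag : T -> {set G}) : Prop :=
  [/\ is_tree T,
      forall v : G, exists t : T, v \in bag t,
      forall u v : G, edge u v -> exists t : T, u \in bag t /\ v \in bag t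
    & forall (v : G) (s t : T), v \in bag s -> v \in bag t ->
        connect [rel x y : T | [&& edge x y, v \in bag x & v \in bag y]] s t].

Definition max_bag_size (G T : sgraph) (bag : T -> {set G}) : nat :=
  \max_(t : T) #|bag t|.

(* Stated with [k.+1] rather than a truncated "max bag size - 1": the graph
   without vertices (of treewidth -1) satisfies this for no [k : nat]. *)
Definition has_treewidth (G : sgraph) (k : nat) : Prop :=
  (exists (T : sgraph) (bag : T -> {set G}),
      tree_decomposition bag /\ max_bag_size bag = k.+1) /\
  (forall (T : sgraph) (bag : T -> {set G}),
      tree_decomposition bag -> k.+1 <= max_bag_size bag).

(* The triple (x, y, z) stands for the cell
   [x, x + 1] * [y, y + 1] * [z, z + 1]. *)
Definition voxel : Type := (int * int * int)%type.

(* Two cells share a face iff they agree in two coordinates and differ by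
   exactly 1 in the remaining one, i.e. are at l1-distance 1. *)
Definition voxel_adj : rel voxel := fun p q =>
  (`|p.1.1 - q.1.1| + `|p.1.2 - q.1.2| + `|p.2 - q.2| == 1)%N.

Definition is_blob (B : {fset voxel}) : Prop :=
  B != fset0 /\
  forall a b : B, connect [rel x y : B | voxel_adj (val x) (val y)] a b.

Definition voxel_representation (G : sgraph) (B : G -> {fset voxel}) : Prop :=
  [/\ forall v : G, is_blob (B v),
      forall u v : G, u != v -> [disjoint B u & B v]%fset
    & forall u v : G, u != v ->
        ((exists p q : voxel, [/\ p \in B u, q \in B v & voxel_adj p q])
         <-> edge u v)].

Definition representation_size (G : sgraph) (B : G -> {fset voxel}) : nat :=
  \sum_(v : G) #|` B v|.

(* Main.v *)
Require Import Defs.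
From mathcomp Require Import all_boot all_order all_algebra finmap.
From mathcomp Require Import reals.
From mathcomp Require Import zify.

(** A face adjacency between voxels witnesses at most one edge, and a voxel has
    six neighbours, so a graph of minimum degree [d] on [n] vertices needs
    [n * d / 6] voxels.  The join of a clique on [tau] vertices with an
    independent set has minimum degree at least [tau].  It has treewidth
    [tau]: the cliques made of the [tau] vertices and one independent vertex
    are the bags of a star-shaped decomposition, and in any decomposition some
    bag contains a given clique. *)

Set Implicit Arguments.
Unset Strict Implicit.
Unset Printing Implicit Defensive.

Import GRing.Theory Num.Theory.

(** * Cliques and tree decompositions *)

Definition clique (G : sgraph) (K : {set G}) : Prop :=
  {in K &, forall u v, u != v -> edge u v}.

(* A walk that avoids [t], followed by one that avoids [s], never uses the
   edge [st]; together with this edge it contains a cycle. *)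
Lemma tree_edge_separates (T : sgraph) (s t w : T) :
  is_tree T -> edge s t ->
  connect [rel x y : T | [&& edge x y, x != t & y != t]] s w ->
  ~ connect [rel x y : T | [&& edge x y, x != s & y != s]] w t.
Proof.
move=> [_ _ acyclic] st sw wt.
pose e := [rel x y : T |
  [&& edge x y, (x != t) || (y != s) & (x != s) || (y != t)]].
have /connectP [p ep def_t] : connect e s t.
  apply: (connect_trans (y := w)).
    by apply: connect_sub sw => x y /= /and3P[xy xt yt];
      apply: connect1; rewrite /= xy xt yt orbT.
  by apply: connect_sub wt => x y /= /and3P[xy xs ys];
    apply: connect1; rewrite /= xy xs ys orbT.
move: def_t; case/shortenP: ep => q eq uq _ def_t.
have: size (s :: q) <= 2.
  apply: acyclic; rewrite /ucycle uq andbT /= rcons_path -def_t edge_sym st.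
  by rewrite andbT (sub_path _ eq) // => x y /= /andP[].
(* If [q] is empty then [s = t] and the edge is a loop; if [q] is the single vertex [t], the path is
   the edge that [e] excludes. *)
case: q eq def_t {uq} => [|x [|//]] /= eq def_t _.
  by rewrite def_t edge_irrefl in st.
by move: eq; rewrite -def_t !eqxx !andbF.
Qed.

(** A simple path from [t] to a vertex of [A] never returns to [t], and walks inside [A] never meet
    [t]; so the second vertex of that path reaches all of [A] without passing through [t]. *)
Lemma step_towards (T : sgraph) (A : {set T}) (t w : T) :
  is_tree T -> w \in A -> t \notin A ->
  {in A &, forall x y,
    connect [rel a b : T | [&& edge a b, a \in A & b \in A]] x y} ->
  exists2 s, edge t s & {in A, forall x,
    connect [rel a b : T | [&& edge a b, a != t & b != t]] s x}.
Proof.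
move=> [_ conn _] wA tA connA.
have /connectP [p ep def_w] := conn t w.
move: def_w; case/shortenP: ep => -[|s q] /= eq uq _ def_w.
  by rewrite -def_w wA in tA.
case/andP: eq => ts eq; exists s => // x xA.
have avoid y : y \in A -> y != t by apply: contraTneq => ->.
apply: (connect_trans (y := w)).
  apply/connectP; exists q => //.
  case/andP: uq => t_sq _.
  have sq_t : all (predC1 t) (s :: q).
    by apply/allP => y y_sq; apply: contraNneq t_sq => <-.
  apply: (sub_in_path (P := predC1 t)) sq_t eq => a b at_ bt ab.
  by rewrite /= ab; apply/and3P; split.
apply: connect_sub (connA w x wA xA) => a b /= /and3P[ab aA bA].
by apply: connect1; rewrite /= ab !avoid ?aA ?bA.
Qed.

(* Iterating a map must end in a cycle, and a tree has only those of
   length 2. *)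
Lemma tree_map_edge (T : sgraph) (f : T -> T) :
  is_tree T -> (forall t, edge t (f t)) -> exists t, f (f t) = t.
Proof.
move=> [/card_gt0P [x _] _ acyclic] ef.
(* The iterates of [x] may run through a tail before they cycle; [y] is the first value that recurs,
   after [order f x - i] steps. *)
have /trajectP [i lt_i def_i] := looping_order f x.
pose y := iter i f x.
have period : iter (order f y) f y = y.
  apply/(orbitPcycle 3 4).
  exists (order f x - i).-1; rewrite prednK ?subn_gt0 //.
  by rewrite /y -iterD subnK // ltnW.
have fcyc : fcycle f (orbit f y) by apply/(orbitPcycle 4 0).
have : size (orbit f y) <= 2.
  apply: acyclic; rewrite /ucycle orbit_uniq andbT.
  by apply: sub_cycle fcyc => a b /= /eqP <-.
rewrite size_orbit; case: (order f y) (order_gt0 f y) period => [|[|[|//]]] //=.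
  by move=> _ fy; have := ef y; rewrite fy edge_irrefl.
by exists y.
Qed.

(* If every bag misses a vertex of [K], send each node one step towards the
   bags of a vertex it misses.  This map swaps the ends of some edge, which
   then separates the bags of two vertices of [K]. *)
Lemma clique_sub_bag (G T : sgraph) (bag : T -> {set G}) (K : {set G}) :
  tree_decomposition bag -> clique K -> exists t, K \subset bag t.
Proof.
move=> [treeT coverV coverE connV] cliqueK.
apply/existsP; apply: contraT; rewrite negb_exists => /forallP missK.
have step t : exists s, edge t s /\ exists2 v, v \in K &
    forall x, v \in bag x ->
      connect [rel a b : T | [&& edge a b, a != t & b != t]] s x.
  have /subsetPn [v vK vt] := missK t.
  have [w vw] := coverV v.
  have [| | x y|s ts sA] := @step_towards T [set x | v \in bag x] t w treeT.
  - by rewrite inE.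
  - by rewrite inE.
  - rewrite !inE => vx vy; apply: connect_sub (connV v x y vx vy) => a b ab.
    by apply: connect1; rewrite /= !inE.
  by exists s; split=> //; exists v => // x vx; apply: sA; rewrite inE.
have [f fP] := fin_all_exists step.
have [t ft] := tree_map_edge treeT (fun t => proj1 (fP t)).
have [ts [v vK vP]] := fP t.
have [_ [u uK]] := fP (f t); rewrite ft => uP.
(* Here [t] misses [v] and [f t] misses [u]. A bag holding both puts [w] on both sides of the edge
   between [t] and [f t]. *)
have [w [uw vw]] : exists w, u \in bag w /\ v \in bag w.
  have [<-|uv] := eqVneq u v; first by have [w uw] := coverV u; exists w.
  exact/coverE/cliqueK.
have := uP w uw; rewrite sym_connect_sym; last first.
  by move=> a b /=; rewrite edge_sym (andbC (a != _)).
rewrite edge_sym in ts; by move/(tree_edge_separates treeT ts (vP w vw)).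
Qed.

(** * Degrees and blob sizes *)

Definition voxel_neighbours (p : voxel) : seq voxel :=
  let: (x, y, z) := p in
  [:: (x + 1, y, z); (x - 1, y, z); (x, y + 1, z); (x, y - 1, z);
      (x, y, z + 1); (x, y, z - 1)]%R.

Lemma voxel_adjW (p q : voxel) : voxel_adj p q -> q \in voxel_neighbours p.
Proof.
case: p q => [[x y] z] [[x' y'] z']; rewrite /voxel_adj !inE !xpair_eqE /=.
lia.
Qed.

Lemma size_voxel_neighbours (p : voxel) : size (voxel_neighbours p) = 6.
Proof. by case: p => [[x y] z]. Qed.

(** Each neighbour [u] of [v] claims a pair of adjacent voxels, [p] in [B v] and [q] in [B u].
    Disjointness lets [q] determine [u], so no pair is claimed twice, and each [p] has six
    candidates for [q]. *)
Lemma degree_le_blob (G : sgraph) (B : G -> {fset voxel}) (v : G) :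
  voxel_representation B -> #|[set u | edge v u]| <= 6 * #|` B v|.
Proof.
move=> [_ disj adj].
pose N := voxel_neighbours.
have owner q : \sum_(u : G) (q \in B u : nat) <= 1.
  case: (pickP (fun u => q \in B u)) => [u qu|none]; last first.
    by rewrite big1 // => u _; rewrite none.
  rewrite (bigD1 u) //= big1 ?addn0 ?leq_b1 // => w wu; apply/eqP.
  rewrite eqb0; apply: contraL qu => qw.
  exact: (fdisjointP (disj w u wu)).
rewrite cardsE -sum1_card.
have -> : 6 * #|` B v| = \sum_(p <- B v) \sum_(q <- N p) 1.
  rewrite (eq_bigr (fun=> 6)) => [|p _].
    by rewrite big_const_seq count_predT iter_addn_0.
  by rewrite sum1_size size_voxel_neighbours.
apply: (@leq_trans
    (\sum_(p <- B v) \sum_(q <- N p) \sum_(u : G) (q \in B u : nat))).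
  rewrite (eq_bigr (fun p => \sum_u \sum_(q <- N p) (q \in B u : nat))).
    2: by move=> p _; rewrite exchange_big.
  rewrite exchange_big big_mkcond /=; apply: leq_sum => u _.
  case: ifP => // vu; have {}vu : edge v u by [].
  have nvu : v != u by apply: contraTneq vu => ->; rewrite edge_irrefl.
  have [p [q [pv qu pq]]] := proj2 (adj v u nvu) vu.
  rewrite (big_rem p) //= (big_rem q) ?voxel_adjW //= qu.
  by rewrite -addnA add1n.
by apply: leq_sum => p _; apply: leq_sum => q _.
Qed.

Lemma min_degree_size (G : sgraph) (B : G -> {fset voxel}) (d : nat) :
  voxel_representation B -> (forall v : G, d <= #|[set u | edge v u]|) ->
  d * #|G| <= 6 * representation_size B.
Proof.
move=> repB dP; rewrite mulnC -sum_nat_const big_distrr /=.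
by apply: leq_sum => v _; apply: leq_trans (dP v) (degree_le_blob v repB).
Qed.

Lemma clique_degree (G : sgraph) (K : {set G}) (v : G) :
  clique K -> v \in K -> #|K|.-1 <= #|[set u | edge v u]|.
Proof.
move=> cliqueK vK; rewrite (cardsD1 v) vK; apply/subset_leq_card/subsetP => u.
by rewrite !inE eq_sym => /andP[vu uK]; apply: cliqueK.
Qed.

(** * Stars are trees *)

Section Star.
Variable m : nat.

Definition star_rel : rel 'I_m.+1 :=
  fun i j => (i != j) && ((i == ord0) || (j == ord0)).

Lemma star_sym : symmetric star_rel.
Proof. by move=> i j; rewrite /star_rel eq_sym orbC. Qed.

Lemma star_irrefl : irreflexive star_rel.
Proof. by move=> i; rewrite /star_rel eqxx. Qed.

Definition star : sgraph := SGraph star_sym star_irrefl.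

Lemma star_tree : is_tree star.
Proof.
split; first by rewrite card_ord.
  move=> s t; apply: (connect_trans (y := ord0 : star)).
    have [->//|s0] := eqVneq s (ord0 : star).
    by apply: connect1; rewrite /= /star_rel s0 eqxx orbT.
  have [->//|t0] := eqVneq t (ord0 : star).
  by apply: connect1; rewrite /= /star_rel eq_sym t0 eqxx.
case=> [|x [|y [|z c]]] // /andP[] /= /and3P[xy yz zc] /and3P[].
rewrite !inE !negb_or => /and3P[xny xnz _] /andP[ynz yc] _.
(* If [y] were not the centre, its neighbours [x] and [z] both would be. Once [y] is the centre, the
   successor of [z] on the cycle must be the centre too, a repetition. *)
have y0 : y = ord0.
  apply/eqP; apply: contraT => /negPf yn0; move: xy yz xnz.
  by rewrite /star_rel yn0 orbF => /andP[_ /eqP ->] /andP[_ /eqP ->].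
move: zc; rewrite y0 in xny ynz yc *.
case: c yc => [|w c] /=; rewrite /star_rel /= (eq_sym z ord0) ?inE ?negb_or.
  by rewrite (negPf ynz) (negPf xny) andbF.
by move=> /andP[nw _]; rewrite (negPf ynz) (eq_sym w) (negPf nw) andbF.
Qed.

End Star.

(** * The join of a clique and an independent set *)

Section Join.
Variables k m : nat.

Definition join_vertex : finType := ('I_k + 'I_m.+1)%type.

Definition is_inl (x : join_vertex) : bool := if x is inl _ then true else false.

Definition join_rel : rel join_vertex :=
  fun x y => (x != y) && (is_inl x || is_inl y).

Lemma join_sym : symmetric join_rel.
Proof. by move=> x y; rewrite /join_rel eq_sym orbC. Qed.

Lemma join_irrefl : irreflexive join_rel.
Proof. by move=> x; rewrite /join_rel eqxx. Qed.

Definition join_graph : sgraph := SGraph join_sym join_irrefl.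

(** Star nodes and independent vertices share their indices, so the centre [ord0] carries a bag of
    the same kind as the leaves. *)
Definition join_bag (i : star m) : {set join_graph} :=
  (inr i : join_graph) |: [set inl a | a : 'I_k].

Lemma inl_join_bag (a : 'I_k) (i : star m) : (inl a : join_graph) \in join_bag i.
Proof. by rewrite in_setU1 imset_f. Qed.

Lemma inr_join_bag (j : 'I_m.+1) (i : star m) :
  ((inr j : join_graph) \in join_bag i) = (j == i).
Proof.
rewrite in_setU1 (inj_eq inr_inj); case: imsetP => [[a]//|_].
by rewrite orbF.
Qed.

Lemma card_join_bag (i : star m) : #|join_bag i| = k.+1.
Proof.
rewrite cardsU1 card_imset; last exact: inl_inj.
by rewrite card_ord; case: imsetP => [[]|].
Qed.

Lemma clique_join_bag (i : star m) : clique (join_bag i).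
Proof.
move=> [a|j] [b|l]; rewrite ?inr_join_bag => xi yi xy;
  rewrite /edge /join_graph /join_rel ?xy //.
by rewrite (eqP xi) (eqP yi) eqxx in xy.
Qed.

Lemma in_join_bag (v : join_graph) : exists i, v \in join_bag i.
Proof.
case: v => [a|j]; first by exists ord0; apply: inl_join_bag.
by exists j; rewrite inr_join_bag.
Qed.

Lemma join_decomposition : tree_decomposition join_bag.
Proof.
split; [exact: star_tree | exact: in_join_bag | |].
  move=> [a|i] [b|j]; rewrite /= /join_rel ?andbF //= => _.
  - by exists ord0; rewrite !inl_join_bag.
  - by exists j; rewrite inl_join_bag inr_join_bag.
  - by exists i; rewrite inl_join_bag inr_join_bag.
move=> [a|j] s t.
  have [_ /(_ s t) st _] := star_tree m.
  move=> _ _; apply: connect_sub st => x y xy.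
  by apply: connect1; apply/and3P; split; rewrite ?inl_join_bag.
by rewrite !inr_join_bag => /eqP <- /eqP <-.
Qed.

Lemma join_treewidth : has_treewidth join_graph k.
Proof.
split.
  exists (star m), join_bag; split; first exact: join_decomposition.
  rewrite /max_bag_size (eq_bigr (fun=> k.+1)) => [|i _].
    2: exact: card_join_bag.
  apply/eqP; rewrite eqn_leq (bigmax_sup ord0) // andbT.
  exact/bigmax_leqP.
move=> T bag decT; rewrite -(card_join_bag ord0).
have [t Kt] := clique_sub_bag decT (@clique_join_bag ord0).
exact: leq_trans (subset_leq_card Kt) (leq_bigmax t).
Qed.

(** Every vertex lies in some bag, and each bag is a clique on [k.+1] vertices. *)
Lemma join_degree (v : join_graph) : k <= #|[set u | edge v u]|.
Proof.
have [i vi] := in_join_bag v.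
by have := clique_degree (@clique_join_bag i) vi; rewrite card_join_bag.
Qed.

End Join.

Theorem theorem12 (R : realType) :
  exists c : R, (0 < c)%R /\
    forall tau : nat, 1 <= tau ->
    forall N : nat, exists n : nat, N <= n /\
    exists G : sgraph, [/\ #|G| = n, has_treewidth G tau
      & forall B : G -> {fset voxel}, voxel_representation B ->
          (c * n%:R * tau%:R <= (representation_size B)%:R)%R].
Proof.
(* Six is the number of faces of a voxel. *)
exists (6%:R^-1)%R; split; first by rewrite invr_gt0 ltr0n.
(* The graph has [tau] clique vertices and [N.+1] independent ones, at least one even for [N = 0],
   as a clique on [tau.+1] vertices requires. *)
move=> tau _ N; exists (tau + N.+1); split.
  by rewrite addnS ltnW // ltnS leq_addl.
exists (join_graph tau N); split; first by rewrite card_sum !card_ord.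
  exact: join_treewidth.
move=> B repB.
rewrite -mulrA mulrC ler_pdivrMr ?ltr0n // -!natrM ler_nat mulnC (mulnC _ 6).
have := min_degree_size repB (@join_degree tau N).
by rewrite card_sum !card_ord.
Qed.
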